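(* Let $1\le i<j\le m$. For all sufficiently large positive integers $q$, the number $|M((\mathcal{B}_m^{\{x_i+x_j=1\}})_q)|$ of points $(x_1,\dots,x_m)\in\mathbb{Z}_q^m$ with $x_i+x_j=1$ that lie on no hyperplane $H'_q$ with $H'\in\mathcal{B}_m\setminus\{\{x_i+x_j=1\}\}$ equals $$\begin{cases}(q-2m)^{i-1}(q-2m+1)^{j-i}(q-2m+2)^{m-j} & \text{if } q \text{ is odd},\\ (q-2m)^{i-1}(q-2m+1)^{j-i-1}\big((q-2m+2)^{m-j+1}-(q-2m+1)^{m-j}\big) & \text{if } q \text{ is even}.\end{cases}$$
   Context: For $m\ge1$, the Shi arrangement of type B is the set of affine hyperplanes in $\mathbb{R}^m$ $$\mathcal{B}_m=\{\{x_s=0\},\{x_s=1\}\mid s\in[m]\}\cup\{\{x_s\pm x_t=0\},\{x_s\pm x_t=1\}\mid 1\le s<t\le m\},$$ where $[m]=\{1,\dots,m\}$. For a positive integer $q$ and a hyperplane $H=\{a_1x_1+\dots+a_mx_m=b\}$ with integer coefficients, $H_q=\{x\in\mathbb{Z}_q^m : [a_1]_qx_1+\dots+[a_m]_qx_m=[b]_q\}$ is its reduction modulo $q$, with $\mathbb{Z}_q=\mathbb{Z}/q\mathbb{Z}$. For $H\in\mathcal{B}_m$, the restriction is $\mathcal{B}_m^H=\{H\cap H' : H'\in\mathcal{B}_m\setminus\{H\},\ H\cap H'\neq\emptyset\}$, and $|M((\mathcal{B}_m^H)_q)|$ denotes the number of points of $H_q$ not lying on any $H'_q$ with $H'\in\mathcal{B}_m\setminus\{H\}$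 (the characteristic quasi-polynomial of the restriction). *)

(* Defs.v *)
From mathcomp Require Import all_boot all_order all_algebra.

Set Implicit Arguments.
Unset Strict Implicit.
Unset Printing Implicit Defensive.

Import Order.TTheory GRing.Theory Num.Theory.
Local Open Scope ring_scope.

(* An affine hyperplane with integer coefficients is given by an equation
   (a, b), standing for a_1 x_1 + ... + a_m x_m = b: its reduction modulo q is
   defined through that equation. *)
Definition equation (m : nat) : Type := ('rV[int]_m * int)%type.

Definition lhs (R : pzRingType) m (h : equation m) (x : 'rV[R]_m) : R :=
  \sum_k (h.1 0 k)%:~R * x 0 k.

Definition on_hyperplane (R : pzRingType) m (h : equation m) (x : 'rV[R]_m) :
    bool :=
  lhs h x == h.2%:~R.

(* 'Z_q is Z/qZ only for q > 1. *)
Definition reduction m (h : equation m) (q : nat) : {set 'rV['Z_q]_m} :=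
  [set x | on_hyperplane h x].

(* The linear form x |-> x_s. *)
Definition coord_form m (s : 'I_m) : 'rV[int]_m := delta_mx 0 s.

Definition shiB (m : nat) : seq (equation m) :=
  flatten [seq [:: (coord_form s, 0); (coord_form s, 1)] | s <- enum 'I_m]
  ++ flatten [seq [:: (coord_form s + coord_form t, 0); (coord_form s - coord_form t, 0);
                      (coord_form s + coord_form t, 1); (coord_form s - coord_form t, 1)]
             | s <- enum 'I_m, t <- [seq t : 'I_m <- enum 'I_m | (s < t)%N]].

(* The set M((A^H)_q) of points of H_q that avoid K_q for all other K in A. *)
Definition restriction_complement m (A : seq (equation m)) (H : equation m)
    (q : nat) : {set 'rV['Z_q]_m} :=
  [set x in reduction H q |
    all (fun K => x \notin reduction K q) [seq K <- A | K != H]].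

Lemma shiB_lead m (h : equation m) : h \in shiB m ->
  (h.2 = 0 \/ h.2 = 1) /\
  exists2 s, h.1 0 s = 1 & forall k : 'I_m, (k < s)%N -> h.1 0 k = 0.
Proof.
have lt_neq (k l : 'I_m) : (k < l)%N -> (k == l) = false.
  by move=> lt_kl; apply/eqP => e; rewrite e ltnn in lt_kl.
rewrite mem_cat => /orP[] /flattenP[l].
  case/mapP=> s _ ->; rewrite !inE => /orP[]/eqP-> /=; split; auto;
  exists s => [|k lks]; rewrite mxE !eqxx //=; by rewrite lt_neq.
case/allpairsPdep=> s [t [_]]; rewrite mem_filter => /andP[lst _] ->.
rewrite !inE => /or4P[]/eqP-> /=; (split; first by auto);
  exists s => [|k lks]; rewrite !mxE ?eqxx /= ?(lt_neq s t) ?addr0 ?subr0 //;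
  by rewrite !lt_neq // (ltn_trans lks).
Qed.

(* Distinct equations of shiB m define distinct hyperplanes of R^m, so that
   comparing equations, as restriction_complement does, is the same as
   comparing hyperplanes. *)
Lemma shiB_inj (R : realFieldType) m (h h' : equation m) :
    h \in shiB m -> h' \in shiB m ->
  @on_hyperplane R m h =1 @on_hyperplane R m h' -> h = h'.
Proof.
wlog: h h' / exists s s' : 'I_m, [/\ (s <= s')%N,
    (h.1 0 s = 1) /\ (forall k : 'I_m, (k < s)%N -> h.1 0 k = 0) &
    (h'.1 0 s' = 1) /\ (forall k : 'I_m, (k < s')%N -> h'.1 0 k = 0)].
  move=> W hA hA' hh'.
  have [_ [s s1 s0]] := shiB_lead hA; have [_ [s' s1' s0']] := shiB_lead hA'.
  case: (leqP s s') => [le|/ltnW le]; first by apply: W => //; exists s, s'.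
  apply/esym; apply: W hA' hA (fun x => esym (hh' x)); by exists s', s.
case=> s [s' [les [s1 s0] [s1' s0']]] /shiB_lead[b01 _] /shiB_lead[b01' _] hh'.
have lhsB (g : equation m) (c : R) t :
    lhs g (c *: delta_mx 0 s - delta_mx 0 t) = (g.1 0 s)%:~R * c - (g.1 0 t)%:~R.
  rewrite /lhs (eq_bigr (fun k => (g.1 0 k)%:~R * c * (k == s)%:R
    - (g.1 0 k)%:~R * (k == t)%:R)); last first.
    by move=> k _; rewrite !mxE eqxx /= mulrBr mulrA.
  rewrite sumrB; congr (_ - _).
    by rewrite (bigD1 s) //= eqxx mulr1 big1 ?addr0 // => k /negPf->; rewrite mulr0.
  by rewrite (bigD1 t) //= eqxx mulr1 big1 ?addr0 // => k /negPf->; rewrite mulr0.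
have eq2 : h.2 = h'.2.
  have := hh' 0; rewrite /on_hyperplane /lhs.
  rewrite !big1 => [|k _|k _]; rewrite ?mxE ?mulr0 //.
  by case: b01 b01' => -> [] ->; rewrite ?eqxx // eq_sym ?oner_eq0 // eq_sym oner_eq0.
have key t : h'.1 0 s * (h.2 + h.1 0 t) - h'.1 0 t = h.2.
  have := hh' ((h.2 + h.1 0 t)%:~R *: delta_mx 0 s - delta_mx 0 t).
  rewrite /on_hyperplane !lhsB s1 mul1r -eq2 -!intrM -!intrB !eqr_int.
  by rewrite addrK eqxx => /esym/eqP.
move: les; rewrite leq_eqVlt => /orP[/eqP/val_inj es|lts].
  case: h h' {hh' lhsB s0 s0' b01 b01'} s1 s1' eq2 key => [a b] [a' b'] /=.
  move=> s1 s1' <- key; congr (_, _); apply/rowP => t; move: (key t).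
  rewrite es s1' mul1r -addrA -[RHS]addr0 => /addrI/eqP.
  by rewrite subr_eq0 => /eqP.
have := key s'; rewrite s0' // mul0r s1' sub0r.
by case: b01 => ->.
Qed.

(* Main.v *)
Require Import Defs.
From mathcomp Require Import all_boot all_order all_algebra zify ring.

Import GRing.Theory.
Local Open Scope ring_scope.

(* Write each coordinate of a point of the complement as a signed integer in
   ]-q/2, q/2].  Its absolute value is a position in {1, ..., floor(q/2)}; the
   positions are distinct, and the remaining hyperplanes only restrict the signs
   and indices of letters in consecutive positions.  Recording for each
   coordinate the number of free positions before it, together with its sign,
   loses nothing: inside a block of consecutive occupied positions the letters
   come in the order "increasing positive, then decreasing negative", except
   that the block containing i and j is a concatenation of two such words, the
   first ending in -i or -j and the second starting with j or i.  The
   coordinates s other than i and j can then be chosen independently, with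
   q - 2m, q - 2m + 1 or q - 2m + 2 possibilities according to the position of
   s relative to i and j.  When q is even, q/2 = -q/2 forces the last block to end
   with a positive word, and x_i - x_j = 1 forbids -i, j in the last two
   positions; this accounts for the correction term. *)

(** * Counting occupied positions *)

Section Placements.
Local Open Scope nat_scope.
Context {m : nat}.
Implicit Types (p b k : 'I_m -> nat) (e : 'I_m -> bool) (s t u : 'I_m).

Definition below p n := \sum_t (p t < n).

Lemma belowS p n : below p n.+1 = below p n + \sum_t (p t == n).
Proof.
by rewrite /below -big_split; apply: eq_bigr => t _ /=; rewrite ltnS; case: ltngtP.
Qed.

Lemma eq_below p p' s : (forall t, (p t < p s) = (p' t < p' s)) ->
  below p (p s) = below p' (p' s).
Proof. by move=> pp'; apply: eq_bigr => t _; rewrite pp'. Qed.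

Lemma below_leq p n n' : n <= n' -> below p n <= below p n'.
Proof. by move=> le_n; apply: leq_sum => t _; lia. Qed.

Lemma below_ltn p n s : p s < n -> below p (p s) < below p n.
Proof.
move=> lt_s; rewrite /below (bigD1 s) //= [X in _ < X](bigD1 s) //= ltnn lt_s.
by rewrite add0n add1n ltnS; apply: leq_sum => t _; lia.
Qed.

Lemma below_max p n : (forall s, p s < n) -> below p n = m.
Proof.
by move=> lt_n; rewrite -[RHS]card_ord -sum1_card; apply: eq_bigr => t _; rewrite lt_n.
Qed.

Lemma below_ltm p s : below p (p s) < m.
Proof.
pose n := (\max_t p t).+1; rewrite -[X in _ < X](@below_max p n).
  by apply: below_ltn; rewrite ltnS leq_bigmax.
by move=> t; rewrite ltnS leq_bigmax.
Qed.

Section Injective.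
Variable p : 'I_m -> nat.
Hypothesis p_inj : injective p.

Lemma sum_eq_inj s : \sum_t (p t == p s) = 1.
Proof.
by rewrite (bigD1 s) //= eqxx big1 ?addn0 // => t /negPf ts; rewrite (inj_eq p_inj) ts.
Qed.

Lemma below_next s : below p (p s).+1 = (below p (p s)).+1.
Proof. by rewrite belowS sum_eq_inj addn1. Qed.

Lemma belowS_leq n : below p n.+1 <= (below p n).+1.
Proof.
rewrite belowS; case: (pickP [pred s | p s == n]) => [s /eqP <-|none].
  by rewrite sum_eq_inj addn1.
by rewrite big1 ?addn0 // => t _; have := none t => /= ->.
Qed.

Lemma below_leq_add n d : below p (n + d) <= below p n + d.
Proof.
elim: d => [|d IH]; first by rewrite !addn0.
by rewrite !addnS (leq_trans (belowS_leq _)).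
Qed.

Lemma below_leq_sub n n' : n <= n' -> below p n' <= below p n + (n' - n).
Proof. by move=> le_n; have := below_leq_add n (n' - n); rewrite subnKC. Qed.

(** An injective [p] lets [below] grow by at most one per step, so growth by the full length of the
    interval leaves no position in it free. *)
Lemma below_tight n n' r : n' - n + below p n <= below p n' -> n <= r < n' ->
  exists u, p u = r.
Proof.
move=> tight /andP[le_nr lt_rn'].
case: (pickP [pred s | p s == r]) => [u /eqP|none]; first by exists u.
have : below p r.+1 = below p r.
  by rewrite belowS big1 ?addn0 // => t _; have := none t => /= ->.
have := below_leq_sub _ _ le_nr; have := below_leq_sub _ _ lt_rn'; lia.
Qed.

Hypothesis p_gt0 : forall s, 0 < p s.

Lemma below_one : below p 1 = 0.
Proof. by rewrite /below big1 // => t _; have := p_gt0 t; lia. Qed.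

Lemma below_lt s : below p (p s) < p s.
Proof. have := below_leq_sub _ _ (p_gt0 s); have := p_gt0 s; rewrite below_one; lia. Qed.

End Injective.

(* [p] and [e] give the absolute values and the signs ([true] for minus) of the
   coordinates; [E] tells whether the modulus is even. *)
Record placement (h : nat) (E : bool) (a a' : 'I_m) p e : Prop := Placement {
  pl_inj : injective p;
  pl_gt0 : forall s, 0 < p s;
  pl_gt1 : forall s, ~~ e s -> 1 < p s;
  pl_leq : forall s, p s + (E && e s) <= h;
  pl_adj : forall s t, p t = (p s).+1 ->
    if e s then if e t then t < s else (s == a) && (t == a') else e t || (s < t);
  pl_neg : e a;
  pl_pos : ~~ e a';
  pl_next : p a' = (p a).+1;
  pl_last : E -> a < a' -> p a' != h }.

(* [b s] is the number of free positions before [s]; the elements of the block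
   with [b = b a] form a word of increasing positive ([k = 0]), decreasing
   negative ([k = 1], ending in [a]), increasing positive ([k = 2], starting at
   [a']) and decreasing negative ([k = 3]) letters. *)
Record coding (B : nat) (E : bool) (a a' : 'I_m) b k : Prop := Coding {
  cd_b : forall s, b s < B;
  cd_k : forall s, k s < 4;
  cd_first : forall s, b s = 0 -> k s <> 0;
  cd_last : forall s, E -> (b s).+1 = B -> k s <> 3;
  cd_one : forall s, k s = 1 -> b s = b a /\ a <= s;
  cd_two : forall s, k s = 2 -> b s = b a /\ a' <= s;
  cd_neg : k a = 1;
  cd_pos : k a' = 2;
  cd_exc : E -> a < a' -> (b a).+1 = B -> exists2 u, u != a' & k u = 2 }.

(** The order in which letters are placed: by block, by segment, then by index, reversed in the
    negative segments. Mixed radix packs it into one number, so that [below] applies; [m - s] can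
    equal [m], whence the base [m.+1]. *)
Definition key b k s :=
  (b s * 4 + k s) * m.+1 + (if odd (k s) then m - s else s).

Lemma ltn_lex M x y r r' : r < M -> r' < M ->
  (x * M + r < y * M + r') = (x < y) || (x == y) && (r < r').
Proof. by move=> rM r'M; apply/idP/idP; case: (ltngtP x y) => [?|?|->]; nia. Qed.

Lemma eqn_lex M x y r r' : r < M -> r' < M ->
  (x * M + r == y * M + r') = (x == y) && (r == r').
Proof.
by move=> rM r'M; rewrite !eqn_leq ![_ * _ + _ <= _]leqNgt !ltn_lex //; lia.
Qed.

Section Key.
Variables b k : 'I_m -> nat.
Hypothesis k_lt4 : forall s, k s < 4.

Lemma ltn_key s t : (key b k s < key b k t) =
  (b s < b t) || (b s == b t) && ((k s < k t) || (k s == k t) &&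
    if odd (k s) then t < s else s < t).
Proof.
have lt_tail u : (if odd (k u) then m - u else u) < m.+1
  by have := ltn_ord u; case: odd; lia.
rewrite /key !ltn_lex // eqn_lex // -orbA -andbA -andb_orr.
case: (b s == b t); rewrite ?andbF // !andTb; congr (_ || (_ || _)).
case: eqP => //= ->; have := ltn_ord s; have := ltn_ord t; case: odd => //; lia.
Qed.

Lemma key_inj : injective (key b k).
Proof.
move=> s t eq_key; have := ltn_key s t; have := ltn_key t s.
rewrite eq_key ltnn; case: (ltngtP (b s) (b t)) => //= _.
case: (ltngtP (k s) (k t)) => //= ->; case: odd => st ts; apply: val_inj => /=; lia.
Qed.
End Key.

(** Before [s] come [b s] free positions and the letters of smaller key; the successor makes
    positions start at 1. *)
Definition position b k s := (b s + below (key b k) (key b k s)).+1.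

(** * From codings to placements *)

Section Coding.
Variables (B : nat) (E : bool) (a a' : 'I_m) (b k : 'I_m -> nat).
Hypothesis C : coding B E a a' b k.
Local Notation K := (key b k).
Local Notation p := (position b k).
Let ltK := ltn_key b k (cd_k _ _ _ _ _ _ C).

Lemma position_ltn s t : (p s < p t) = (K s < K t).
Proof.
have mono u v : K u < K v -> p u < p v.
  move=> lt_uv; rewrite /position !ltnS -addnS leq_add ?below_ltn //.
  by move: lt_uv; rewrite ltK; lia.
apply/idP/idP => [lt_p|]; last exact: mono.
case: (ltngtP (K s) (K t)) => // [/mono|/(key_inj _ _ (cd_k _ _ _ _ _ _ C)) est]; first lia.
by rewrite est ltnn in lt_p.
Qed.

Lemma below_position s : below p (p s) = below K (K s).
Proof. by apply: eq_below => t; rewrite position_ltn. Qed.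

Lemma block_pair : b a' = b a.
Proof. by have [] := cd_two _ _ _ _ _ _ C _ (cd_pos _ _ _ _ _ _ C). Qed.

Lemma position_inj : injective p.
Proof.
move=> s t est; apply: (key_inj b k); first exact: cd_k C.
by have := position_ltn s t; have := position_ltn t s; rewrite est ltnn; lia.
Qed.

(** With [m] letters on [h] positions, [h - m] positions are free, which leaves [B = h - m + 1]
    possible values for [b]. *)
Lemma coding_placement h : B + m = h.+1 ->
  placement h E a a' p (fun s => odd (k s)).
Proof.
move=> Bh; have [b_lt k_lt b0 bl k1 k2 ka ka' exc] := C; have bp := block_pair.
have Kaa' : K a < K a' by rewrite ltK bp ka ka' eqxx orbT.
have p_le s : p s <= h by have := b_lt s; have := below_ltm K s; rewrite /position; lia.
(* No key lies strictly between: [cd_one] makes [a] the last letter of its decreasing segment, and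
   [cd_two] makes [a'] the first of its increasing one. *)
have p_aa' : p a' = (p a).+1.
  suff: below K (K a') = (below K (K a)).+1 by rewrite /position bp => ->; rewrite addnS.
  rewrite -(below_next K (key_inj _ _ k_lt)); apply: eq_bigr => u _; congr (nat_of_bool _).
  rewrite ltnS [RHS]leqNgt; apply/idP/idP; last first.
    case: (ltngtP (K u) (K a)) => // [lt_ua _|/(key_inj _ _ k_lt) -> //].
    exact: ltn_trans lt_ua Kaa'.
  rewrite !ltK bp ka ka' /=; have := k1 u; have := k2 u; have := k_lt u.
  by case: (k u) => [|[|[|[|]]]] //=; lia.
split=> //.
- exact: position_inj.
(* In the first block [cd_first] leaves only segment 2 to a positive letter, so [a] comes before
   it. *)
- move=> s even_s; rewrite /position ltnS; case: (posnP (b s)) => [bs0|]; last lia.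
  suff : below K (K a) < below K (K s) by lia.
  apply: below_ltn; rewrite ltK; have := b0 s bs0; have := k2 s; have := k_lt s.
  by move: even_s; rewrite ka; case: (k s) => [|[|[|[|]]]] //=; lia.
(* For [E] true, a negative letter at [h] would lie in the last block, hence in segment 1 by
   [cd_last]; but then [a'] comes after it. *)
- move=> s; have := p_le s; case: E bl => [bl|_]; last by rewrite addn0.
  case odd_s: (odd (k s)); last by rewrite addn0.
  rewrite leq_eqVlt addn1 => /orP[/eqP|//]; rewrite /position => ps.
  have := b_lt s; have := below_ltm K s => lt_m lt_B.
  have lasts : (b s).+1 = B by lia.
  have := bl s isT lasts; have := k_lt s => lt4 n3.
  have ks : k s = 1 by case: (k s) odd_s lt4 n3 => [|[|[|[|]]]].
  have [bs _] := k1 s ks.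
  have : below K (K s) < below K (K a') by apply: below_ltn; rewrite ltK ks ka' bp bs eqxx orbT.
  by have := below_ltm K a'; lia.
(* Consecutive positions share a block and have no letter between them. Tested on [a] and [a'], this
   excludes passing from segment 0 to 2 or from 1 to 3, and allows 1 to 2 only from [a] to [a']. *)
- move=> s t pt; have lt_st : K s < K t by rewrite -position_ltn pt.
  have bst : b s = b t.
    have := below_ltn K (K t) s lt_st; move: lt_st pt; rewrite ltK /position; lia.
  have nobetween u : K s < K u -> K u < K t -> False.
    by rewrite -!position_ltn pt; lia.
  have := nobetween a; have := nobetween a'; move: lt_st.
  have := k1 s; have := k2 t; have := k1 t; have := k2 s; have := k_lt s; have := k_lt t.
  rewrite -!val_eqE !ltK bp ka ka' bst ltnn eqxx /= => lt4t lt4s.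
  by case: (k s) lt4s => [|[|[|[|]]]] //; case: (k t) lt4t => [|[|[|[|]]]] //=; lia.
- by rewrite ka.
- by rewrite ka'.
(* [cd_exc] provides another letter of segment 2, which comes after [a']. *)
- move=> HE lt_aa'; apply/eqP => pa'.
  have := b_lt a'; have := below_ltm K a' => lt_m lt_B.
  have lasta : (b a).+1 = B by rewrite -bp; move: pa'; rewrite /position; lia.
  have [u ua' ku] := exc HE lt_aa' lasta; have [bu le_u] := k2 u ku.
  have : K a' < K u by rewrite ltK bp bu ku ka' ltnn !eqxx /=; rewrite -val_eqE /= in ua'; lia.
  by rewrite -position_ltn pa' ltnNge p_le.
Qed.

End Coding.

(** * From placements to codings *)

Definition free_before p s := p s - (below p (p s)).+1.

(** The first branch singles out, in the block of [a], the negative letters up to [a] (value 1) and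
    the positive ones after [a] (value 2). *)
Definition segment (a : 'I_m) p e s : nat :=
  if (free_before p s == free_before p a) && (e s == (p s <= p a)) then
    2 - e s else 3 * e s.

Section Placement.
Variables (B h : nat) (E : bool) (a a' : 'I_m) (p : 'I_m -> nat) (e : 'I_m -> bool).
Hypotheses (P : placement h E a a' p e) (Bh : B + m = h.+1).
Local Notation b := (free_before p).
Local Notation k := (segment a p e).
Local Notation K := (key b k).
Let p_inj := pl_inj _ _ _ _ _ _ P.
Let p_gt0 := pl_gt0 _ _ _ _ _ _ P.

Lemma free_beforeE s : p s = (b s + below p (p s)).+1.
Proof. have := below_lt p p_inj p_gt0 s; rewrite /free_before; lia. Qed.

Lemma free_before_leq s t : p s <= p t -> b s <= b t.
Proof.
move=> le_st; have := below_leq_sub p p_inj _ _ le_st.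
have := free_beforeE s; have := free_beforeE t; lia.
Qed.

(** Equal numbers of free positions before [s] and [t] mean that none lies between them. *)
Lemma free_before_block s t r : b s = b t -> p s <= r < p t ->
  exists2 u, p u = r & b u = b s.
Proof.
move=> bst /andP[le_sr lt_rt].
have [|u pu] := below_tight p p_inj (p s) (p t) r _ (introT andP (conj le_sr lt_rt)).
  have := free_beforeE s; have := free_beforeE t; lia.
exists u => //; have := free_before_leq s u; have := free_before_leq u t; lia.
Qed.

Lemma odd_segment s : odd (k s) = e s.
Proof. by rewrite /segment; case: ifP => _; case: (e s). Qed.

Lemma segment_lt4 s : k s < 4.
Proof. by rewrite /segment; case: ifP => _; case: (e s). Qed.

Lemma free_before_pair : b a' = b a.
Proof.
have pa' := pl_next _ _ _ _ _ _ P; have := below_next p p_inj a.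
rewrite -pa'; have := free_beforeE a'; have := free_beforeE a; lia.
Qed.

(** Along a block the segment never drops: the only passage from negative to positive is from [a] to
    [a'], that is from 1 to 2. Within a segment, [pl_adj] prescribes the order of the indices. *)
Lemma key_next s t : b s = b t -> p t = (p s).+1 -> K s < K t.
Proof.
move=> bst pt; rewrite ltn_key; last exact: segment_lt4.
rewrite odd_segment bst ltnn eqxx /= /segment bst pt.
have := pl_adj _ _ _ _ _ _ P s t pt; have pa' := pl_next _ _ _ _ _ _ P.
have ea := pl_neg _ _ _ _ _ _ P; have ea' := negbTE (pl_pos _ _ _ _ _ _ P).
have bp := free_before_pair.
case es: (e s); case et: (e t) => /=.
- by case: (b t == b a) => //=; case: (ltngtP (p s) (p a)) => //= -> ->.
- case/andP=> /eqP es' /eqP et'; move: bst pt; subst s t => _ _.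
  by rewrite bp eqxx leqnn ltnn.
- move=> _; case: (b t == b a) => //=; case: (leqP (p s) (p a)) => //=; last first.
    by case: (ltnP (p s) (p a)) => //; lia.
  by case: (ltnP (p s) (p a)).
- case: (b t == b a) => //=; case: (ltngtP (p s) (p a)) => //.
Qed.

(** Induction on the distance: either the number of free positions grows, or the position after [s]
    is occupied in the same block and [key_next] applies. *)
Lemma key_ltn s t : p s < p t -> K s < K t.
Proof.
move: {2}(p t - p s) (leqnn (p t - p s)) => d; elim: d s => [|d IH] s; first lia.
move=> le_d lt_st; have := free_before_leq s t (ltnW lt_st).
rewrite leq_eqVlt => /orP[/eqP bst|]; last by rewrite ltn_key //; [lia | exact: segment_lt4].
case: (ltngtP (p t) (p s).+1) => [|lt_t|pt]; [lia | | exact: key_next].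
have [|u pu bu] := free_before_block s t (p s).+1 bst; first lia.
by apply: ltn_trans (key_next s u _ pu) (IH u _ _); rewrite ?bu // pu; lia.
Qed.

Lemma ltn_key_placement s t : (K s < K t) = (p s < p t).
Proof.
apply/idP/idP; last exact: key_ltn.
case: (ltngtP (p s) (p t)) => // [/key_ltn|/p_inj ->]; lia.
Qed.

Lemma position_free_before s : position b k s = p s.
Proof.
rewrite [RHS]free_beforeE; congr (_ + _).+1; apply: eq_below => t.
exact: ltn_key_placement.
Qed.

Lemma segment_leq s t : b s = b t -> p s <= p t -> k s <= k t.
Proof.
rewrite leq_eqVlt => bst /orP[/eqP/p_inj -> //|/key_ltn].
rewrite ltn_key; [lia | exact: segment_lt4].
Qed.

Lemma placement_coding : coding B E a a' b k.
Proof.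
have [_ _ p_gt1 p_le adj ea ea' pa' last] := P.
have bp := free_before_pair; have pE := free_beforeE.
have p_lt s : p s < h.+1 by have := p_le s; lia.
have bm := below_max p _ p_lt.
have b_lt s : b s < B.
  have := below_leq_sub p p_inj _ _ (ltnW (p_lt s)).
  by rewrite bm; have := pE s; have := p_lt s; lia.
have ka : k a = 1 by rewrite /segment eqxx ea leqnn.
have ka' : k a' = 2 by rewrite /segment bp eqxx pa' ltnn (negbTE ea').
(* A block with no free position before it starts at 1; the block with [B - 1] of them before it
   ends at [h]. *)
have first_letter s : b s = 0 -> exists2 u, p u = 1 & b u = 0 /\ p u <= p s.
  move=> bs; have := p_gt0 s; rewrite leq_eqVlt => /orP[/eqP ps|ps].
    by exists s; rewrite -?ps.
  have [|u pu] := below_tight p p_inj 1 (p s) 1 _ ps.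
    by rewrite (below_one p p_gt0); have := pE s; rewrite bs; lia.
  by exists u => //; rewrite pu; split=> //; have := pE u; lia.
have last_letter s : (b s).+1 = B -> exists2 u, p u = h & b u = b s.
  move=> bs; have [||u pu] := below_tight p p_inj (p s) h.+1 h.
  - by rewrite bm; have := pE s; have := p_lt s; lia.
  - by have := p_lt s; lia.
  exists u => //; have := free_before_leq s u; have := b_lt u; have := p_lt s; lia.
have tail_leq s t : b s = b t -> k s = k t -> p s <= p t -> if e s then t <= s else s <= t.
  move=> bst kst; rewrite leq_eqVlt => /orP[/eqP/p_inj ->|/key_ltn].
    by rewrite leqnn if_same.
  rewrite ltn_key; last exact: segment_lt4.
  by rewrite odd_segment bst kst !ltnn !eqxx /=; case: ifP => _ /ltnW.
split=> //.
- exact: segment_lt4.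
(* Segments only rise along a block, and the letter at position 1 is negative by [pl_gt1]. *)
- move=> s bs ks; have [u pu [bu le_us]] := first_letter s bs.
  have : k u <= 0 by rewrite -ks segment_leq ?bu.
  have : e u by apply: contraT => /p_gt1; lia.
  by rewrite -odd_segment; case: (k u).
- move=> s HE bs ks; have [u pu bu] := last_letter s bs.
  have : 3 <= k u by rewrite -ks segment_leq ?bu // pu; have := p_lt s; lia.
  have := segment_lt4 u; have := odd_segment u; have := p_le u.
  rewrite HE pu; case: (e u); first lia.
  by case: (k u) => [|[|[|[|]]]].
- move=> s ks; suff [bs le_s] : b s = b a /\ p s <= p a.
    split=> //; have := tail_leq s a; rewrite -odd_segment ks ka; exact.
  move: ks; rewrite /segment; case: ifP; last by case: (e s).
  by case/andP=> /eqP -> /eqP; case: (e s) => // <-.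
- move=> s ks; suff [bs le_s] : b s = b a /\ p a' <= p s.
    split=> //; have := tail_leq a' s; rewrite -odd_segment bp bs ks ka'; exact.
  move: ks; rewrite /segment; case: ifP; last by case: (e s).
  by case/andP=> /eqP -> /eqP; rewrite pa' ltnNge; case: (e s) => // <-.
(* The letter at [h] differs from [a'] by [pl_last] and is positive by [pl_leq]; coming after [a'],
   it lies in segment 2. *)
- move=> HE lt_aa' ba; have [u pu bu] := last_letter a ba.
  exists u; first by apply: contra (last HE lt_aa') => /eqP <-; rewrite pu.
  have : 2 <= k u by rewrite -ka' segment_leq ?bu // pu; have := p_lt a'; lia.
  have := segment_lt4 u; have := odd_segment u; have := p_le u.
  rewrite HE pu; case: (e u); first lia.
  by case: (k u) => [|[|[|[|]]]].
Qed.

End Placement.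

(** * Coding a placement undoes placing a coding *)

Section Inverse.
Variables (B : nat) (E : bool) (a a' : 'I_m) (b k : 'I_m -> nat).
Hypothesis C : coding B E a a' b k.
Local Notation p := (position b k).

Lemma free_before_position s : free_before p s = b s.
Proof.
by rewrite /free_before (below_position _ _ _ _ _ _ C) /position subSS addnK.
Qed.

Lemma segment_position s : segment a p (fun t => odd (k t)) s = k s.
Proof.
have [_ k_lt _ _ k1 k2 ka ka' _] := C; have bp := block_pair _ _ _ _ _ _ C.
rewrite /segment !free_before_position leqNgt (position_ltn _ _ _ _ _ _ C) ltn_key //.
have := k1 s; have := k2 s; have := k_lt s; rewrite ka.
case ks: (k s) => [|[|[|[|]]]] //= _.
- by move=> _ _; case: (b s =P b a) => [->|] //; rewrite ltnn eqxx.
- by move=> _ [] // -> le_as; rewrite !eqxx ltnn [s < a]ltnNge le_as.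
- by case=> // -> _ _; rewrite eqxx ltnn.
- by move=> _ _; case: (b s =P b a) => [->|] //; rewrite ltnn eqxx.
Qed.

End Inverse.
End Placements.

(** * The linear forms of the arrangement over a ring *)

Section Reduction.
Context {R : pzRingType} {m : nat}.
Implicit Types (u v : 'rV[int]_m) (x : 'rV[R]_m) (c d : int) (s t : 'I_m).

Lemma lhs_coord s c x : lhs (coord_form s, c) x = x 0 s.
Proof.
rewrite /lhs (bigD1 s) //= mxE !eqxx mul1r big1 ?addr0 // => t /negPf ts.
by rewrite mxE ts andbF mul0r.
Qed.

Lemma lhsD u v c d x : lhs (u + v, c) x = lhs (u, d) x + lhs (v, d) x.
Proof.
by rewrite /lhs -big_split; apply: eq_bigr => t _; rewrite mxE intrD mulrDl.
Qed.

Lemma lhsN u c d x : lhs (- u, c) x = - lhs (u, d) x.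
Proof.
by rewrite /lhs -sumrN; apply: eq_bigr => t _; rewrite mxE intrN mulNr.
Qed.

Lemma lhs_add_coord s t c x : lhs (coord_form s + coord_form t, c) x = x 0 s + x 0 t.
Proof. by rewrite (lhsD _ _ _ 0) !lhs_coord. Qed.

Lemma lhs_sub_coord s t c x : lhs (coord_form s - coord_form t, c) x = x 0 s - x 0 t.
Proof. by rewrite (lhsD _ _ _ 0) (lhsN _ _ 0) !lhs_coord. Qed.

Definition lhsE := (lhs_coord, lhs_add_coord, lhs_sub_coord).

End Reduction.

(** * The complement described by coordinates *)

Section Arrangement.
Context {m : nat}.
Variables (i j : 'I_m).
Hypothesis lt_ij : (i < j)%N.

(** [restriction_complement] compares equations; this lemma and the next two help to check that it
    discards only the sum equation of the pair [(i, j)] with constant 1. *)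
Lemma coord_neq (s : 'I_m) (c : int) :
  ((coord_form s, c) : equation m) != (coord_form i + coord_form j, 1).
Proof.
apply/eqP => -[/rowP eq_form _].
have := eq_form i; have := eq_form j; rewrite !mxE !eqxx /=.
have ij : (i == j) = false by rewrite -val_eqE /=; lia.
rewrite [j == i]eq_sym ij; case: (j =P s) => [<-|_] //; by rewrite ij.
Qed.

Lemma sub_coord_neq (s t : 'I_m) (c : int) : (s < t)%N ->
  ((coord_form s - coord_form t, c) : equation m) != (coord_form i + coord_form j, 1).
Proof.
move=> lt_st; apply/eqP => -[/rowP eq_form _]; have := eq_form t; rewrite !mxE !eqxx /=.
have -> : (t == s) = false by rewrite -val_eqE /=; lia.
by case: eqP => _; case: eqP.
Qed.

Lemma add_coord_eq (s t : 'I_m) : (s < t)%N ->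
  ((coord_form s + coord_form t, 1) == (coord_form i + coord_form j, 1) :> equation m)
  = ((s, t) == (i, j)).
Proof.
move=> lt_st; apply/eqP/eqP => [[/rowP eq_form]|[-> ->] //].
have := eq_form s; have := eq_form t; rewrite !mxE !eqxx /=.
have ts : (t == s) = false by rewrite -val_eqE /=; lia.
have st : (s == t) = false by rewrite eq_sym.
rewrite ts st; case: (t =P i) => ti; case: (t =P j) => tj //=;
  case: (s =P i) => si; case: (s =P j) => sj //= _ _.
- by move: ts; rewrite ti si eqxx.
- by move: lt_st; rewrite ti sj => /ltn_trans/(_ lt_ij); rewrite ltnn.
- by rewrite si tj.
- by move: ts; rewrite tj sj eqxx.
Qed.

Lemma restriction_complementP q (x : 'rV['Z_q]_m) :
  reflect [/\ x 0 i + x 0 j = 1,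
    forall s, x 0 s != 0 /\ x 0 s != 1 &
    forall s t : 'I_m, (s < t)%N -> [/\ x 0 s + x 0 t != 0, x 0 s - x 0 t != 0,
      x 0 s - x 0 t != 1 & (s, t) != (i, j) -> x 0 s + x 0 t != 1]]
  (x \in restriction_complement (shiB m) (coord_form i + coord_form j, 1) q).
Proof.
rewrite inE all_filter inE /on_hyperplane !lhsE /= mulr1z.
apply: (iffP andP) => [[/eqP -> /allP H]|[-> S T]].
  have {}H h : h \in shiB m -> h != (coord_form i + coord_form j, 1) -> lhs h x != h.2%:~R.
    by move=> /H /= /implyP hK /hK; rewrite inE.
  have mem1 s c : c \in [:: 0; 1] -> (coord_form s, c) \in shiB m.
    move=> Hc; rewrite mem_cat; apply/orP; left; apply/flattenP.
    exists [:: (coord_form s, 0); (coord_form s, 1)]; first by apply: map_f; rewrite mem_enum.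
    by move: Hc; rewrite !inE => /orP[]/eqP->; rewrite eqxx ?orbT.
  have mem2 (s t : 'I_m) h : (s < t)%N ->
      h \in [:: (coord_form s + coord_form t, 0); (coord_form s - coord_form t, 0);
                (coord_form s + coord_form t, 1); (coord_form s - coord_form t, 1)] ->
      h \in shiB m.
    move=> lt_st h_in; rewrite mem_cat; apply/orP; right; apply/flattenP; eexists; last exact: h_in.
    apply/allpairsPdep; exists s, t; split; rewrite ?mem_enum //.
    by rewrite mem_filter lt_st mem_enum.
  split=> // [s|s t lt_st].
    have := H _ (mem1 s 0 isT) (coord_neq s 0); have := H _ (mem1 s 1 isT) (coord_neq s 1).
    by rewrite !lhsE.
  have M h := mem2 s t h lt_st; split.
  - have := H (coord_form s + coord_form t, 0); rewrite !lhsE; apply; last by apply/eqP => -[].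
    by apply: M; rewrite !inE eqxx.
  - have := H (coord_form s - coord_form t, 0); rewrite !lhsE; apply; last by apply/eqP => -[].
    by apply: M; rewrite !inE eqxx ?orbT.
  - have := H (coord_form s - coord_form t, 1); rewrite !lhsE; apply; last exact: sub_coord_neq.
    by apply: M; rewrite !inE eqxx ?orbT.
  - have := H (coord_form s + coord_form t, 1); rewrite !lhsE add_coord_eq // => H1 ne.
    by apply: H1 => //; apply: M; rewrite !inE eqxx ?orbT.
split=> //; apply/allP => h /=; rewrite mem_cat => /orP[]/flattenP[l].
  case/mapP => s _ -> ; have [s0 s1] := S s.
  by rewrite !inE => /orP[]/eqP->; rewrite /on_hyperplane !lhsE /= ?s0 ?s1 implybT.
case/allpairsPdep=> s [t [_]]; rewrite mem_filter => /andP[lt_st _] ->.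
have [st0 st0' st1' st1] := T s t lt_st.
rewrite !inE => /or4P[]/eqP->; rewrite /on_hyperplane !lhsE /=; apply/implyP=> // ne.
by apply: st1; move: ne; rewrite add_coord_eq.
Qed.

End Arrangement.

(** * Residues as signed integers, and points as placements *)

Section Modular.
Local Open Scope nat_scope.
(** The form [q'.+2] lets ['Z_q] reduce to ['I_q]. *)
Variable q' : nat.
Local Notation q := q'.+2.
Hypothesis q_gt2 : 2 < q.
Implicit Types x y : 'Z_q.

(* Residues are taken in the interval ]-q/2, q/2]. *)
Definition negative x := q./2 < x.
Definition magnitude x := if negative x then q - x else x.
Definition residue (p : nat) (e : bool) : 'Z_q := inZp (if e then q - p else p).

Lemma residue_ltn x : x < q.
Proof. exact: ltn_ord. Qed.

Lemma magnitude_eq0 x : (x == 0%R) = (magnitude x == 0).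
Proof.
rewrite -val_eqE /= /magnitude /negative; have x_lt := residue_ltn x.
by case: ltnP => /=; lia. Qed.

Lemma magnitude_eq1 x : (x == 1%R) = ~~ negative x && (magnitude x == 1).
Proof.
rewrite -val_eqE /= modn_small // /magnitude /negative.
by have x_lt := residue_ltn x; case: ltnP => /=; lia.
Qed.

Lemma magnitude_leq x : magnitude x + (~~ odd q && negative x) <= q./2.
Proof.
rewrite /magnitude /negative; have x_lt := residue_ltn x.
by case: ltnP => /=; lia.
Qed.

Lemma modn_add v w : v < q -> w < q -> (v + w) %% q = if v + w < q then v + w else v + w - q.
Proof.
move=> v_lt w_lt; case: ltnP => [/modn_small //|le_q].
by rewrite -{1}(subnK le_q) modnDr modn_small //; lia.
Qed.

Lemma add_eq0 x y : (x + y == 0)%R || (x - y == 0)%R = (magnitude x == magnitude y).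
Proof.
rewrite subr_eq0 -!val_eqE /= modn_add; try exact: ltn_ord.
rewrite /magnitude /negative; have x_lt := residue_ltn x; have y_lt := residue_ltn y.
by case: (ltnP (q./2) x); case: (ltnP (q./2) y); case: (ltnP (x + y) q) => /=; lia.
Qed.

(** Equal signs are impossible: the magnitudes would have to add up to 1, [q + 1] or [q - 1], and
    distinct positive ones cannot. *)
Lemma add_eq1 x y : 0 < magnitude x -> 0 < magnitude y -> magnitude x != magnitude y ->
  (x + y == 1)%R = if negative x then ~~ negative y && (magnitude y == (magnitude x).+1)
                   else negative y && (magnitude x == (magnitude y).+1).
Proof.
rewrite -!val_eqE /= modn_add; try exact: ltn_ord.
rewrite [1 %% _]modn_small //.
rewrite /magnitude /negative; have x_lt := residue_ltn x; have y_lt := residue_ltn y.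
by case: (ltnP (q./2) x); case: (ltnP (q./2) y); case: (ltnP (x + y) q) => /=; lia.
Qed.

(** For [x] negative and [y] not, the magnitudes must add up to [q - 1]. Being distinct and at most
    [q./2], they do so only for even [q], with [x = 1 - q/2] and [y = q/2]. *)
Lemma sub_eq1 x y : 0 < magnitude x -> 0 < magnitude y -> magnitude x != magnitude y ->
  (x - y == 1)%R = if negative x then
      if negative y then magnitude y == (magnitude x).+1
      else [&& ~~ odd q, magnitude y == q./2 & (magnitude x).+1 == q./2]
    else ~~ negative y && (magnitude x == (magnitude y).+1).
Proof.
rewrite GRing.subr_eq -!val_eqE /= [1 %% _]modn_small // modn_add; try exact: ltn_ord; last by [].
rewrite /magnitude /negative; have x_lt := residue_ltn x; have y_lt := residue_ltn y.
by case: (ltnP (q./2) x); case: (ltnP (q./2) y); case: (ltnP (1 + y) q) => /=; lia.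
Qed.

Lemma magnitudeK x : residue (magnitude x) (negative x) = x.
Proof.
apply: val_inj; rewrite /= /magnitude; have x_lt := residue_ltn x.
have q_eq : (Zp_trunc q).+2 = q by [].
by case: (negative x); rewrite modn_small ?q_eq //; lia.
Qed.

Lemma residueK p e : 0 < p -> p + (~~ odd q && e) <= q./2 ->
  magnitude (residue p e) = p /\ negative (residue p e) = e.
Proof.
move=> p_gt0 p_le; have q_eq : (Zp_trunc q).+2 = q by [].
rewrite /magnitude /negative [residue p e : nat]/= modn_small; last first.
  by rewrite q_eq; case: e p_le => /=; lia.
by case: e p_le; case: ltnP => /=; lia.
Qed.


Context {m : nat}.
Variables (i j : 'I_m).
Hypothesis lt_ij : i < j.
Implicit Types X : 'rV['Z_q]_m.
Local Notation V := (restriction_complement (shiB m) (coord_form i + coord_form j, 1)%R q).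
Local Notation E := (~~ odd q).

(* [z] is the sign of x_i. *)
Definition orient (z : bool) := if z then (i, j) else (j, i).

Lemma complement_placement X : X \in V -> let a := orient (negative (X 0%R i)) in
  placement q./2 E a.1 a.2 (fun s => magnitude (X 0%R s)) (fun s => negative (X 0%R s)).
Proof.
case/restriction_complementP=> // sum_ij nz pair a.
have p_gt0 s : 0 < magnitude (X 0%R s).
  by have [+ _] := nz s; rewrite magnitude_eq0 lt0n.
have p_lt (s t : 'I_m) : s < t -> magnitude (X 0%R s) != magnitude (X 0%R t).
  by move=> /(pair s)[+ + _ _]; rewrite -add_eq0 negb_or => -> ->.
have p_neq s t : s != t -> magnitude (X 0%R s) != magnitude (X 0%R t).
  by rewrite -val_eqE neq_ltn => /orP[/p_lt //|/p_lt]; rewrite eq_sym.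
have p_inj : injective (fun s => magnitude (X 0%R s)).
  by move=> s t /eqP; apply: contraTeq => /p_neq.
have ij : i != j by rewrite -val_eqE neq_ltn lt_ij.
(* Since x_i + x_j = 1, exactly one of the two is negative, namely [a.1], and the other occupies the
   next position. *)
have /esym := add_eq1 (X 0%R i) (X 0%R j) (p_gt0 i) (p_gt0 j) (p_neq i j ij).
rewrite sum_ij eqxx => signs.
have [ea ea' pa'] : [/\ negative (X 0%R a.1), ~~ negative (X 0%R a.2) &
    magnitude (X 0%R a.2) = (magnitude (X 0%R a.1)).+1].
  rewrite /a /orient; move: signs.
  by case ei: (negative (X 0%R i)) => /=; rewrite ?ei => /andP[? /eqP ->].
split=> //.
- by move=> s /= pos_s; have [_] := nz s; rewrite magnitude_eq1 pos_s /=; have := p_gt0 s; lia.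
- by move=> s; exact: magnitude_leq.
- move=> s t pt; have st : s != t by apply/eqP => est; move: pt; rewrite est; lia.
  have ts : t != s by rewrite eq_sym.
  (* Adjacency orders the letters by position, the arrangement by index; hence both orders of [s]
     and [t]. *)
  have st1 := add_eq1 (X 0%R s) (X 0%R t) (p_gt0 s) (p_gt0 t) (p_neq s t st).
  have ts1 := add_eq1 (X 0%R t) (X 0%R s) (p_gt0 t) (p_gt0 s) (p_neq t s ts).
  have dst := sub_eq1 (X 0%R s) (X 0%R t) (p_gt0 s) (p_gt0 t) (p_neq s t st).
  have dts := sub_eq1 (X 0%R t) (X 0%R s) (p_gt0 t) (p_gt0 s) (p_neq t s ts).
  have := st; rewrite -val_eqE neq_ltn => /orP lt_or.
  case es: (negative (X 0%R s)); case et: (negative (X 0%R t)) => //=;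
    move: st1 ts1 dst dts; rewrite es et pt eqxx //= => st1 ts1 dst dts.
  + by case: lt_or => // /(pair s)[_ _]; rewrite dst.
  + case: lt_or => [/(pair s)|/(pair t)] [_ _ _].
      rewrite st1 => only_ij; have /eqP[es' et'] : (s, t) == (i, j) by apply: contraT => /only_ij.
      by rewrite /a /orient -es' es es' et' !eqxx.
    rewrite ts1 => only_ij; have /eqP[et' es'] : (t, s) == (i, j) by apply: contraT => /only_ij.
    by rewrite /a /orient -et' et es' et' !eqxx.
  + by case: lt_or => // /(pair t)[_ _]; rewrite dts.
(* If x_i is negative, position [q./2] for [j] would give x_i - x_j = 1 by wrap-around; otherwise
   [a.1 < a.2] reads [j < i] and fails. *)
- move=> even_q; rewrite /a /orient in ea ea' pa' *; case: ifP ea ea' pa' => /= _ ei ej pj.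
    move=> _; apply/eqP => pjh; have [_ _ + _] := pair i j lt_ij.
    have := sub_eq1 (X 0%R i) (X 0%R j) (p_gt0 i) (p_gt0 j) (p_neq i j ij).
    by rewrite ei (negbTE ej) -pj pjh even_q eqxx => ->.
  by rewrite ltnNge (ltnW lt_ij).
Qed.

Lemma placement_complement X z : let a := orient z in
  placement q./2 E a.1 a.2 (fun s => magnitude (X 0%R s)) (fun s => negative (X 0%R s)) ->
  X \in V /\ negative (X 0%R i) = z.
Proof.
move=> a [p_inj /= p_gt0 p_gt1 p_leq adj ea ea' pa' last].
have p_neq s t : s != t -> magnitude (X 0%R s) != magnitude (X 0%R t).
  by move=> st; rewrite (inj_eq p_inj).
have ij : i != j by rewrite -val_eqE neq_ltn lt_ij.
split; last by move: ea ea'; rewrite /a /orient; case: (z) => //= _ /negbTE.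
apply/restriction_complementP=> //; split=> [|s|s t lt_st].
- apply/eqP; rewrite add_eq1 ?p_neq //.
  by move: ea ea' pa'; rewrite /a /orient; case: (z) => /= ea /negbTE ea' ->; rewrite ea ea' eqxx.
- rewrite magnitude_eq0 magnitude_eq1 -lt0n p_gt0 negb_and; split=> //.
  by case es: (negative _) => //=; have := p_gt1 s; rewrite es => /(_ isT); lia.
have st : s != t by rewrite -val_eqE neq_ltn lt_st.
have := add_eq0 (X 0%R s) (X 0%R t); rewrite (negbTE (p_neq s t st)) => /norP[st0 st0'].
rewrite (add_eq1 (X 0%R s) (X 0%R t)) ?p_neq // sub_eq1 ?p_neq //; split=> //.
- case es: (negative (X 0%R s)); case et: (negative (X 0%R t)); apply/negP => //.
  + by move=> /eqP/adj; rewrite es et ltnNge ltnW.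
  (* The wrap-around case: adjacency identifies [s] and [t] with [a.1] and [a.2], against
     [pl_last]. *)
  + case/and3P=> even_q /eqP pt /eqP ps; have := adj s t; rewrite es et pt ps => /(_ erefl).
    case/andP=> /eqP sa /eqP ta; move: (last even_q); rewrite -sa -ta lt_st pt eqxx.
    by move=> not_last; have := not_last isT.
  + by move=> /eqP/adj; rewrite es et ltnNge ltnW.
move=> ne; apply: contra ne.
case es: (negative (X 0%R s)); case et: (negative (X 0%R t)) => //= /eqP/adj; rewrite es et.
  move: ea ea'; rewrite /a /orient; case: (z) => //= _ _ /andP[/eqP sa /eqP ta].
  by move: lt_st; rewrite sa ta ltnNge (ltnW lt_ij).
move: ea ea'; rewrite /a /orient; case: (z) => //= _ _ /andP[/eqP ta /eqP sa].
  by move: lt_st; rewrite sa ta ltnNge (ltnW lt_ij).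
by rewrite sa ta.
Qed.

End Modular.

(** * Counting the choices coordinate by coordinate *)

Section Counting.
Local Open Scope nat_scope.

Lemma card_family_prod (aT rT : finType) (F : aT -> {set rT}) :
  #|family F| = \prod_s #|F s|.
Proof. by rewrite card_family foldrE big_image. Qed.

Lemma prod_ranges m (i j : 'I_m) (u v w : nat) (f : nat -> nat) : i < j ->
  (forall s, s < i -> f s = u) -> f i = 1 ->
  (forall s, i < s < j -> f s = v) -> f j = 1 ->
  (forall s, j < s < m -> f s = w) ->
  \prod_(s < m) f s = u ^ i * v ^ (j - i - 1) * w ^ (m - j.+1).
Proof.
move=> lt_ij fu fi fv fj fw; have lt_jm := ltn_ord j.
rewrite -(big_mkord xpredT f) (@big_cat_nat _ _ _ i) //=; last by rewrite ltnW.
rewrite (@big_cat_nat _ _ _ j i) ?(ltnW lt_ij) ?(ltnW lt_jm) //=.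
rewrite [X in _ * (X * _)]big_ltn // [X in _ * (_ * X)]big_ltn // fi fj !mul1n mulnA.
rewrite (@eq_big_nat _ _ _ 0 _ _ (fun=> u)) => [|s /andP[_ /fu] //].
rewrite (@eq_big_nat _ _ _ i.+1 _ _ (fun=> v)) => [|s /fv //].
rewrite (@eq_big_nat _ _ _ j.+1 _ _ (fun=> w)) => [|s /fw //].
by rewrite !prod_nat_const_nat subn0 subnS subn1.
Qed.

Context {m : nat}.
Variables (n : nat) (E : bool).
Local Notation letter := ('I_n.+1 * 'I_4)%type.
Implicit Types (a s : 'I_m) (beta : 'I_n.+1).

(** Once the block [beta] of [a] and [a'] is fixed, all conditions of [coding] except [cd_exc] bear
    on single coordinates, so their solutions form a product. Here [n] is [B - 1]. *)
Definition options a a' beta s : {set letter} :=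
  [set c : letter |
    [&& (c.1 == 0 :> nat) ==> (c.2 != 0 :> nat),
        E && (c.1 == n :> nat) ==> (c.2 != 3 :> nat),
        (c.2 == 1 :> nat) ==> (c.1 == beta) && (a <= s),
        (c.2 == 2 :> nat) ==> (c.1 == beta) && (a' <= s) &
        if s == a then c == (beta, inord 1)
        else (s == a') ==> (c == (beta, inord 2))]].

(* The sequences of options that violate [cd_exc] in the last block. *)
Definition degenerate a a' beta s : {set letter} :=
  [set c in options a a' beta s | (s != a') ==> (c.2 != 2 :> nat)].

Definition codings a a' beta : {set {ffun 'I_m -> letter}} :=
  [set c | (c \in family (options a a' beta)) &&
    ~~ [&& E, a < a', beta == n :> nat & c \in family (degenerate a a' beta)]].

Lemma codingsP a a' beta (c : {ffun 'I_m -> letter}) : a != a' ->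
  reflect (coding n.+1 E a a' (fun s => (c s).1) (fun s => (c s).2) /\ (c a).1 = beta)
    (c \in codings a a' beta).
Proof.
move=> aa'; rewrite inE; apply: (iffP andP) => [[/familyP c_in exc]|[C ca1]].
  have {}c_in s := c_in s.
  have ca : c a = (beta, inord 1).
    by have := c_in a; rewrite inE eqxx => /and5P[_ _ _ _ /eqP].
  have ca' : c a' = (beta, inord 2).
    by have := c_in a'; rewrite inE [a' == a]eq_sym (negbTE aa') eqxx => /and5P[_ _ _ _ /eqP].
  split; last by rewrite ca.
  split=> /= [s|s|s|s HE|s|s|||HE lt_aa'].
  - exact: ltn_ord.
  - exact: ltn_ord.
  - by move=> bs; have := c_in s; rewrite inE bs eqxx => /andP[/eqP].
  - case=> bs; have := c_in s; rewrite inE bs eqxx HE => /and3P[_ /eqP]; done.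
  - move=> ks; have := c_in s; rewrite inE ks => /and5P[_ _ /andP[/eqP -> ->] _ _].
    by rewrite ca.
  - move=> ks; have := c_in s; rewrite inE ks => /and5P[_ _ _ /andP[/eqP -> ->] _].
    by rewrite ca.
  - by rewrite ca /= inordK.
  - by rewrite ca' /= inordK.
  rewrite ca => -[/= lastb]; move: exc; rewrite HE lt_aa' lastb eqxx /= => /familyP not_deg.
  case: (pickP [pred u | (u != a') && ((c u).2 == 2 :> nat)]) => [u /andP[? /eqP]|none].
    by exists u.
  case: not_deg => s; have := none s; have := c_in s; rewrite /= inE => c_s.
  by rewrite /degenerate inE inE c_s /= => /negbT; rewrite negb_and implybE.
have [b_lt k_lt b0 bl k1 k2 ka ka' exc] := C.
have bp := block_pair _ _ _ _ _ _ C.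
have c_in s : c s \in options a a' beta s.
  rewrite inE; apply/and5P; split.
  - by apply/implyP=> /eqP/b0/eqP.
  - by apply/implyP=> /andP[HE /eqP bs]; apply/eqP/bl; rewrite ?bs.
  - by apply/implyP=> /eqP/k1[bs ->]; rewrite -ca1 -val_eqE /= bs eqxx.
  - by apply/implyP=> /eqP/k2[bs ->]; rewrite -ca1 -val_eqE /= bs eqxx.
  case: eqP => [->|_]; last apply/implyP=> /eqP ->.
    by rewrite -pair_eqE /pair_eq /= ca1 eqxx -val_eqE /= ka inordK.
  by rewrite -pair_eqE /pair_eq /= -ca1 -!val_eqE /= bp ka' inordK // !eqxx.
split; first by apply/familyP.
apply/negP => /and4P[HE lt_aa' /eqP lastb /familyP deg].
have [|u ua' ku] := exc HE lt_aa'; first by rewrite ca1 lastb.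
by have := deg u; rewrite inE ua' ku andbF.
Qed.

Lemma card_letters (P : letter -> bool) : #|[set c | P c]| =
  \sum_(b < n.+1) P (b, inord 0) + \sum_(b < n.+1) P (b, inord 1)
  + \sum_(b < n.+1) P (b, inord 2) + \sum_(b < n.+1) P (b, inord 3).
Proof.
rewrite -sum1_card big_mkcond /=.
rewrite (eq_bigr (fun c : letter => nat_of_bool (P (c.1, c.2)))); last first.
  by case=> b k _; rewrite inE; case: P.
rewrite -(pair_big xpredT xpredT (fun b k => nat_of_bool (P (b, k)))) /= exchange_big /=.
rewrite 4!big_ord_recl big_ord0 addn0 !addnA; do 3?congr (_ + _);
  apply: eq_bigr => b _; congr (nat_of_bool (P (_, _))); apply: val_inj; by rewrite /= inordK.
Qed.

Lemma card_sum_eq beta (P : bool) : \sum_(b < n.+1) (b == beta) && P = P.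
Proof.
rewrite (bigD1 beta) //= eqxx big1 ?addn0 // => b /negPf -> //.
Qed.

(** Segment 0 excludes the first block, segment 3 excludes the last one if [E], and segments 1 and 2
    admit at most the block [beta]. *)
Lemma card_letters_block beta (P1 P2 : bool) :
  #|[set c : letter |
    [&& (c.1 == 0 :> nat) ==> (c.2 != 0 :> nat),
        E && (c.1 == n :> nat) ==> (c.2 != 3 :> nat),
        (c.2 == 1 :> nat) ==> (c.1 == beta) && P1 &
        (c.2 == 2 :> nat) ==> (c.1 == beta) && P2]]| = n + P1 + P2 + (n + ~~ E).
Proof.
rewrite card_letters /= !inordK //=; congr (_ + _ + _ + _).
- rewrite big_ord_recl /= add0n (eq_bigr (fun=> 1)) => [|b _]; last by rewrite implybT.
  by rewrite sum1_card card_ord.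
- by rewrite -[RHS](card_sum_eq beta); apply: eq_bigr => b _; rewrite !implybT !andbT.
- by rewrite -[RHS](card_sum_eq beta); apply: eq_bigr => b _; rewrite !implybT.
rewrite big_ord_recr /= (eq_bigr (fun=> 1)) => [|b _].
  by rewrite sum1_card card_ord eqxx implybT andbT; case: E.
by rewrite implybT andbT (ltn_eqF (ltn_ord b)) andbF.
Qed.

Lemma card_options a a' beta s : s != a -> s != a' ->
  #|options a a' beta s| = n + (a < s) + (a' < s) + (n + ~~ E).
Proof.
move=> sa sa'; have -> : (a < s) = (a <= s) by rewrite ltn_neqAle eq_sym sa.
have -> : (a' < s) = (a' <= s) by rewrite ltn_neqAle eq_sym sa'.
rewrite -(card_letters_block beta); apply: eq_card => c.
by rewrite !inE (negbTE sa) (negbTE sa') andbT.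
Qed.

Lemma card_degenerate a a' beta s : s != a -> s != a' ->
  #|degenerate a a' beta s| = n + (a < s) + (n + ~~ E).
Proof.
move=> sa sa'; have -> : (a < s) = (a <= s) by rewrite ltn_neqAle eq_sym sa.
(* Forbidding segment 2 amounts to taking [P2] false. *)
transitivity (n + (a <= s) + false + (n + ~~ E)); last by rewrite addn0.
rewrite -(card_letters_block beta); apply: eq_card => c.
by rewrite !inE (negbTE sa) (negbTE sa'); case: (c.2 == 2 :> nat); rewrite /= ?andbF ?andbT.
Qed.

Lemma options_special a a' beta s : a != a' -> (s == a) || (s == a') ->
  options a a' beta s = [set (beta, inord (s == a').+1)].
Proof.
move=> aa' /orP[]/eqP->; rewrite ?eqxx ?(negbTE aa'); apply/setP => -[b k]; rewrite !inE.
  rewrite eqxx /=; case: ((b, k) =P _) => [[-> ->]|]; last by rewrite !andbF.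
  by rewrite inordK //= eqxx leqnn !implybT.
rewrite [a' == a]eq_sym (negbTE aa') eqxx /=; case: ((b, k) =P _) => [[-> ->]|];
  last by rewrite !andbF.
by rewrite inordK //= eqxx leqnn !implybT.
Qed.

Lemma degenerate_special a a' beta s : a != a' -> (s == a) || (s == a') ->
  degenerate a a' beta s = options a a' beta s.
Proof.
move=> aa' sp; apply/setP => c; rewrite inE options_special // inE.
case: eqP => //= ->; move: sp; case: (s == a') => //=; by rewrite inordK.
Qed.

End Counting.

(** * Invariance under pointwise equality, for functions read off matrices and finite functions *)

Section Extensionality.
Local Open Scope nat_scope.
Context {m : nat}.
Implicit Types (b k p : 'I_m -> nat) (e : 'I_m -> bool).

Lemma eq_coding B E (a a' : 'I_m) b b1 k k1 : b =1 b1 -> k =1 k1 ->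
  coding B E a a' b k -> coding B E a a' b1 k1.
Proof.
move=> eb ek [b_lt k_lt b0 bl k1' k2 ka ka' exc].
split=> [s|s|s|s|s|s|||HE aa']; rewrite -?eb -?ek //; [exact: b0 | exact: bl | exact: k1'
  | exact: k2 | move=> ba].
by have [u ? ku] := exc HE aa' ba; exists u; rewrite -?ek.
Qed.

Lemma eq_placement h E (a a' : 'I_m) p p1 e e1 : p =1 p1 -> e =1 e1 ->
  placement h E a a' p e -> placement h E a a' p1 e1.
Proof.
move=> ep ee [p_inj p_gt0 p_gt1 p_leq adj ea ea' pa' last].
split=> [s t|s|s|s|s t||||HE aa']; rewrite -?ep -?ee //;
  [exact: p_inj | exact: p_gt1 | exact: adj | exact: last].
Qed.

Lemma eq_position b b1 k k1 : b =1 b1 -> k =1 k1 -> position b k =1 position b1 k1.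
Proof.
move=> eb ek s; have eK t : key b k t = key b1 k1 t by rewrite /key eb ek.
by rewrite /position eb; congr (_ + _).+1; apply: eq_below => t; rewrite !eK.
Qed.

Lemma eq_free_before p p1 : p =1 p1 -> free_before p =1 free_before p1.
Proof.
by move=> ep s; rewrite /free_before (@eq_below _ p p1) => [|t]; rewrite !ep.
Qed.

Lemma eq_segment (a : 'I_m) p p1 e e1 : p =1 p1 -> e =1 e1 ->
  segment a p e =1 segment a p1 e1.
Proof. by move=> ep ee s; rewrite /segment !(eq_free_before _ _ ep) !ep ee. Qed.

End Extensionality.

(** * The total number of codings *)

Section Total.
Local Open Scope nat_scope.
Context {m : nat}.
Variables (i j : 'I_m) (n : nat) (E : bool).
Hypothesis lt_ij : i < j.
(** This is [q - 2 * m] when [n = q./2 - m] and [E] says that [q] is even. *)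
Local Notation y := (n + (n + ~~ E)).

Lemma orient_neq z : (orient i j z).1 != (orient i j z).2.
Proof. by case: z; rewrite -val_eqE neq_ltn lt_ij ?orbT. Qed.

Lemma orient_mem z s : (s == (orient i j z).1) || (s == (orient i j z).2) =
  (s == i) || (s == j).
Proof. by case: z => //=; rewrite orbC. Qed.

(** The number of options depends only on how [s] compares with [i] and [j], so every sign and every
    block give the same product. *)
Lemma prod_options z beta : let a := orient i j z in
  \prod_s #|options n E a.1 a.2 beta s| =
  y ^ i * (y + 1) ^ (j - i - 1) * (y + 2) ^ (m - j.+1).
Proof.
move=> a; pose f (s : nat) := if (s == i) || (s == j) then 1 else y + (i < s) + (j < s).
transitivity (\prod_(s < m) f s).
  apply: eq_bigr => s _; rewrite /f; case: ifP => sij; last first.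
    have := sij; rewrite !val_eqE -(orient_mem z) => /norP[sa sa'].
    by rewrite card_options // /a /orient; case: (z) => /=; lia.
  by rewrite options_special ?cards1 ?orient_neq ?orient_mem.
apply: prod_ranges => // [s lt_si||s /andP[lt_is lt_sj]||s /andP[lt_js _]]; rewrite /f.
- by rewrite !ltn_eqF //=; lia.
- by rewrite eqxx.
- by rewrite gtn_eqF // ltn_eqF //=; lia.
- by rewrite eqxx orbT.
- by rewrite !gtn_eqF //=; lia.
Qed.

Lemma prod_degenerate beta : \prod_s #|degenerate n E i j beta s| =
  y ^ i * (y + 1) ^ (j - i - 1) * (y + 1) ^ (m - j.+1).
Proof.
have ij := orient_neq true; pose f (s : nat) := if (s == i) || (s == j) then 1 else y + (i < s).
transitivity (\prod_(s < m) f s).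
  apply: eq_bigr => s _; rewrite /f; case: ifP => sij; last first.
    have := sij; rewrite !val_eqE => /norP[sa sa'].
    by rewrite card_degenerate //; lia.
  by rewrite degenerate_special // options_special // cards1.
apply: prod_ranges => // [s lt_si||s /andP[lt_is lt_sj]||s /andP[lt_js _]]; rewrite /f.
- by rewrite !ltn_eqF //=; lia.
- by rewrite eqxx.
- by rewrite gtn_eqF // ltn_eqF //=; lia.
- by rewrite eqxx orbT.
- by rewrite !gtn_eqF //=; lia.
Qed.

(** The sequences removed because of [cd_exc] form a product too; adding them back avoids truncated
    subtraction. *)
Lemma card_codings a a' beta : #|codings (m := m) n E a a' beta| +
    [&& E, a < a' & beta == n :> nat] * \prod_s #|degenerate n E a a' beta s| =
  \prod_s #|options n E a a' beta s|.
Proof.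
rewrite -!card_family_prod -[RHS]cardsE.
rewrite -(cardsID [set c | [&& E, a < a', beta == n :> nat &
  c \in family (degenerate n E a a' beta)]]) addnC; congr (_ + _); last first.
  by apply: eq_card => c; rewrite !inE andbC.
case: and3P => [[HE lt_aa' lastb]|not_cond]; rewrite ?mul1n ?mul0n.
  apply: eq_card => c; rewrite in_setI !in_set HE lt_aa' lastb /=.
  apply/idP/andP => [c_deg|[] //]; split=> //; apply/familyP => s.
  by move/familyP/(_ s): c_deg; rewrite inE => /andP[].
apply/esym/eqP; rewrite cards_eq0; apply/eqP/setP => c; rewrite !inE.
by apply/negP => /andP[_ /and4P[HE lt_aa' lastb _]]; apply: not_cond.
Qed.

Definition total_codings : {set bool * 'I_n.+1 * {ffun 'I_m -> 'I_n.+1 * 'I_4}} :=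
  [set d | d.2 \in codings n E (orient i j d.1.1).1 (orient i j d.1.1).2 d.1.2].

(** The factor [n.+1.*2] counts the sign of x_i and the block [beta]. The correction arises once:
    only x_i negative gives [a < a'], and [beta] must be the last block. *)
Lemma card_total_codings : #|total_codings| +
    E * (y ^ i * (y + 1) ^ (j - i - 1) * (y + 1) ^ (m - j.+1)) =
  n.+1.*2 * (y ^ i * (y + 1) ^ (j - i - 1) * (y + 2) ^ (m - j.+1)).
Proof.
pose a z := (orient i j z).1; pose a' z := (orient i j z).2.
have -> : #|total_codings| =
    \sum_(z : bool) \sum_(beta < n.+1) #|codings n E (a z) (a' z) beta|.
  rewrite -sum1_card pair_big /=.
  rewrite (eq_bigr (fun zb => \sum_(c in codings n E (a zb.1) (a' zb.1) zb.2) 1)); last first.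
    by move=> zb _; rewrite sum1_card.
  by rewrite pair_big_dep /=; apply: eq_bigl => -[zb c]; rewrite inE.
rewrite -(prod_degenerate ord_max).
have -> : E * \prod_s #|degenerate n E i j ord_max s| = \sum_(z : bool) \sum_(beta < n.+1)
    [&& E, a z < a' z & beta == n :> nat] * \prod_s #|degenerate n E (a z) (a' z) beta s|.
  rewrite big_bool /= [X in _ = _ + X]big1 ?addn0 => [|beta _]; last first.
    by rewrite ltnNge (ltnW lt_ij) andbF.
  rewrite (bigD1 ord_max) //= eqxx andbT lt_ij andbT [X in _ = _ + X]big1 ?addn0 // => beta.
  by rewrite -val_eqE /= => /negbTE ->; rewrite !andbF.
rewrite -big_split /= (eq_bigr (fun=> n.+1 *
    (y ^ i * (y + 1) ^ (j - i - 1) * (y + 2) ^ (m - j.+1)))); last first.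
  move=> z _; rewrite -big_split /= (eq_bigr _ (fun beta _ => card_codings (a z) (a' z) beta)).
  by rewrite (eq_bigr _ (fun beta _ => prod_options z beta)) sum_nat_const card_ord.
by rewrite sum_nat_const card_bool mulnA mul2n.
Qed.

End Total.

Lemma card_bij_in (T U : finType) (A : {set T}) (B : {set U}) (f : T -> U) (g : U -> T) :
  {in A, forall x, f x \in B} -> {in B, forall y, g y \in A} ->
  {in A, cancel f g} -> {in B, cancel g f} -> #|A| = #|B|.
Proof.
move=> fA gB fK gK; rewrite -(card_in_imset (can_in_inj fK)).
apply: eq_card => y; apply/imsetP/idP => [[x xA ->]|yB]; first exact: fA.
by exists (g y); rewrite ?gK ?gB.
Qed.

(** * The bijection between the complement and the codings *)

Section Bijection.
Local Open Scope nat_scope.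
Variables (m q' n : nat) (i j : 'I_m).
Local Notation q := q'.+2.
Local Notation E := (~~ odd q).
Hypotheses (q_gt2 : 2 < q) (lt_ij : i < j) (nm : n.+1 + m = q./2.+1).
Local Notation V := (restriction_complement (shiB m) (coord_form i + coord_form j, 1)%R q).

Definition encode (X : 'rV['Z_q]_m) : bool * 'I_n.+1 * {ffun 'I_m -> 'I_n.+1 * 'I_4} :=
  let z := negative q' (X 0%R i) in let a := (orient i j z).1 in
  let p s := magnitude q' (X 0%R s) in
  (z, inord (free_before p a),
   [ffun s => (inord (free_before p s), inord (segment a p (fun t => negative q' (X 0%R t)) s))]).

Definition decode (d : bool * 'I_n.+1 * {ffun 'I_m -> 'I_n.+1 * 'I_4}) : 'rV['Z_q]_m :=
  \row_s residue q' (position (fun t => (d.2 t).1) (fun t => (d.2 t).2) s) (odd (d.2 s).2).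

Lemma card_complement : #|V| = #|total_codings i j n E|.
Proof.
have enc X : X \in V -> let a := orient i j (negative q' (X 0%R i)) in
    let p s := magnitude q' (X 0%R s) in let e s := negative q' (X 0%R s) in
    [/\ placement q./2 E a.1 a.2 p e, coding n.+1 E a.1 a.2 (free_before p) (segment a.1 p e),
      (fun s => ((encode X).2 s).1 : nat) =1 free_before p &
      (fun s => ((encode X).2 s).2 : nat) =1 segment a.1 p e].
  move=> /(complement_placement _ q_gt2 _ _ lt_ij) P a p e.
  (* The bounds in [C] ensure that [inord] keeps every value. *)
  have C := placement_coding _ _ _ _ _ _ _ P nm; split=> // s; rewrite ffunE /= inordK //.
    exact: cd_b C s.
  exact: cd_k C s.
have dec d : d \in total_codings i j n E -> let a := orient i j d.1.1 in
    let b s := (d.2 s).1 : nat in let k s := (d.2 s).2 : nat in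
    [/\ coding n.+1 E a.1 a.2 b k, (d.2 a.1).1 = d.1.2,
      (fun s => magnitude q' (decode d 0%R s)) =1 position b k &
      (fun s => negative q' (decode d 0%R s)) =1 (fun s => odd (k s))].
  rewrite inE => /(codingsP _ _ _ _ _ _ (orient_neq _ _ lt_ij _))[C ca] a b k.
  have P := coding_placement _ _ _ _ _ _ C _ nm.
  have res s := residueK _ q_gt2 _ _ (pl_gt0 _ _ _ _ _ _ P s) (pl_leq _ _ _ _ _ _ P s).
  by split=> // s; rewrite mxE; have [] := res s.
have decP d : d \in total_codings i j n E -> decode d \in V /\ negative q' (decode d 0%R i) = d.1.1.
  move=> /dec[C _ em en]; apply: (placement_complement _ q_gt2 _ _ lt_ij).
  apply: (eq_placement _ _ _ _ _ _ _ _ (fsym em) (fsym en)).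
  exact: coding_placement C _ nm.
apply: (card_bij_in _ _ _ _ encode decode) => [X XV|d /decP[] //|X XV|d dD].
- have [P C eb ek] := enc X XV; rewrite inE; apply/codingsP; first exact: orient_neq.
  split; first exact: eq_coding (fsym eb) (fsym ek) C.
  by rewrite ffunE.
- have [P C eb ek] := enc X XV; apply/rowP => s; rewrite mxE.
  rewrite (eq_position _ _ _ _ eb ek) (position_free_before _ _ _ _ _ _ _ P nm).
  by have := ek s => /= ->; rewrite odd_segment magnitudeK.
have [C ca em en] := dec d dD; have [_ dz] := decP d dD.
rewrite /encode dz; case: d dD C ca em en dz => [[z beta] c] dD /= C ca em en dz.
congr (_, _, _).
  rewrite (eq_free_before _ _ em) (free_before_position _ _ _ _ _ _ C) ca; exact: inord_val.
apply/ffunP => s; rewrite ffunE (eq_free_before _ _ em) (eq_segment _ _ _ _ _ em en).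
rewrite (free_before_position _ _ _ _ _ _ C) (segment_position _ _ _ _ _ _ C) !inord_val.
by case: (c s).
Qed.

End Bijection.

(* i < j are 0-based: they stand for i + 1 < j + 1 in {1, ..., m}. *)
Theorem theorem8p1 (m : nat) (i j : 'I_m) (lt_ij : (i < j)%N) :
  exists q0 : nat, forall q : nat, (1 < q)%N -> (q0 <= q)%N ->
    let x : int := q%:Z - (2 * m)%:Z in
    #|restriction_complement (shiB m) (coord_form i + coord_form j, 1) q|%:Z =
      if odd q then
        x ^+ i * (x + 1) ^+ (j - i) * (x + 2) ^+ (m - j.+1)
      else
        x ^+ i * (x + 1) ^+ (j - i - 1)
        * ((x + 2) ^+ (m - j) - (x + 1) ^+ (m - j.+1)).
Proof.
(* This bound gives [q > 2] and makes [q./2 - m] a genuine subtraction. *)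
have lt_jm := ltn_ord j; exists (2 * m).+2 => -[|[|q']] // _ q_ge x.
pose n := (q'.+2./2 - m)%N; set q := q'.+2 in q_ge x *.
have nm : (n.+1 + m = q./2.+1)%N by rewrite /n /q; lia.
have q_gt2 : (2 < q)%N by lia.
rewrite (card_complement _ _ _ _ _ q_gt2 lt_ij nm).
have := card_total_codings i j n (~~ odd q) lt_ij.
set y := (n + _)%N => /(congr1 Posz).
have yx : y%:Z = x by rewrite /y /x /n /q; lia.
(* For odd [q] this factor raises the exponent of [x + 1] to [j - i]; for even [q] it is [x + 2] and
   raises that exponent to [m - j]. *)
have nx : (n.+1.*2)%:Z = x + 1 + (~~ odd q)%:Z by rewrite -yx /y; lia.
have PoszX a k : (a ^ k)%N%:Z = a%:Z ^+ k by rewrite -!natz natrX.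
rewrite -yx in nx *; clearbody y; rewrite !(PoszD, PoszM, PoszX) nx => total.
have -> : (m - j = (m - j.+1).+1)%N by lia.
set d := (j - i - 1)%N in total *; have -> : (j - i = d.+1)%N by lia.
rewrite !exprS; case: (odd q) total => /= total; last rewrite mul1r in total.
  by rewrite mul0r addr0 in total; rewrite total; ring.
(* Adding the correction term to both sides turns the difference into the counted sum. *)
by apply: (addIr (y%:Z ^+ i * (y%:Z + 1) ^+ d
  * (y%:Z + 1) ^+ (m - j.+1))); rewrite total; ring.
Qed.
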